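(* Let $A_1$ and $A_2$ be unital Banach algebras with $\Delta(A_i)\neq\emptyset$ for $i=1,2$. Then the following statements hold. (i) If $A_1\hat{\otimes}A_2$ is cyclically amenable, then $A_1$ and $A_2$ are cyclically amenable. (ii) If $A_1\hat{\otimes}A_2$ is weakly amenable, then $A_1$ and $A_2$ are weakly amenable.
   Context: For a Banach algebra $A$, the dual $A^*$ is an $A$-bimodule via $\langle F\cdot a,x\rangle=\langle F,ax\rangle$ and $\langle a\cdot F,x\rangle=\langle F,xa\rangle$. A linear operator $D:A\to A^*$ is a derivation if $D(ab)=D(a)\cdot b+a\cdot D(b)$ for all $a,b\in A$; it is cyclic if $\langle D(a),b\rangle+\langle D(b),a\rangle=0$ for all $a,b\in A$; an inner derivation is one of the form $\mathrm{ad}_F: a\mapsto F\cdot a-a\cdot F$ with $F\in A^*$. $A$ is weakly amenable if every continuous derivation $A\to A^*$ is inner; $A$ is cyclically amenable if every cyclic derivation $A\to A^*$ is inner. $\Delta(A)$ is the character space of $A$ (nonzero multiplicative linear functionals). $A_1\hat{\otimes}A_2$ is the Banach space projective tensor product, with the usual product determined by $(a_1\otimes a_2)(x_1\otimes x_2)=a_1x_1\otimes a_2x_2$. *)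

(* Defs.v *)
From HB Require Import structures.
From mathcomp Require Import all_boot all_order all_algebra.
From mathcomp Require Import complex.
From mathcomp Require Import all_classical reals topology normedtype.

Set Implicit Arguments.
Unset Strict Implicit.
Unset Printing Implicit Defensive.
Import Order.TTheory GRing.Theory Num.Theory.
Import numFieldNormedType.Exports.
Local Open Scope classical_set_scope.
Local Open Scope ring_scope.
Local Open Scope complex_scope.

(* Banach algebras, not necessarily unital.  The product is a new operation:
   Hierarchy Builder rejects a join of algType and normedModType, because the
   earlier numDomainType already inherits from both rings and normed groups. *)
HB.mixin Record isBanachAlgebra (K : numFieldType) A
    & CompleteNormedModule K A := {
  bmul : A -> A -> A;
  bmulA : associative bmul;
  bmulDl : left_distributive bmul +%R;
  bmulDr : right_distributive bmul +%R;
  bmulZl : forall (k : K) a b, bmul (k *: a) b = k *: bmul a b;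
  bmulZr : forall (k : K) a b, bmul a (k *: b) = k *: bmul a b;
  ler_norm_bmul : forall a b, `|bmul a b| <= `|a| * `|b|
}.

#[short(type="banachAlgType")]
HB.structure Definition BanachAlgebra (K : numFieldType) :=
  {A of CompleteNormedModule K A & isBanachAlgebra K A}.

Infix "⊙" := bmul (at level 40, left associativity) : ring_scope.

Definition unital (K : numFieldType) (A : banachAlgType K) : Prop :=
  exists e : A, forall a : A, e ⊙ a = a /\ a ⊙ e = a.

Section RealNorm.
Variables (R : realType) (E : normedModType R[i]).

(* The norm `|x| of a normed space over R[i] is a nonnegative element of R[i];
   rnorm x is the same number in R, where suprema and infima are available. *)
Definition rnorm (x : E) : R := complex.Re `|x|.

Lemma rnormE x : (rnorm x)%:C = `|x|.
Proof. by rewrite RRe_real// ger0_real. Qed.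

Lemma rnorm_ge0 x : 0 <= rnorm x.
Proof. by rewrite -lecR rnormE; exact: normr_ge0. Qed.

Lemma rnormD x y : rnorm (x + y) <= rnorm x + rnorm y.
Proof. by rewrite -lecR rmorphD/= !rnormE ler_normD. Qed.

Lemma rnorm_eq0 x : rnorm x = 0 -> x = 0.
Proof. by move=> x0; apply/normr0_eq0; rewrite -rnormE x0. Qed.

End RealNorm.

Section Dual.
Variables (R : realType) (E : normedModType R[i]).
Local Notation C := (R[i]^o).

Definition dual_pred : {pred E -> C} :=
  [pred f : E -> C | `[< linear f /\ continuous f >]].

Lemma dual_predP (f : E -> C) :
  reflect (linear f /\ continuous f) (f \in dual_pred).
Proof. exact: asboolP. Qed.

Fact dual_submod_closed : submod_closed dual_pred.
Proof.
split; first by apply/dual_predP; split=> [k x y|x];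
  [rewrite /= scaler0 addr0 | exact: cst_continuous].
move=> k f g /dual_predP[lf cf] /dual_predP[lg cg]; apply/dual_predP; split.
  move=> l x y; rewrite !fctE lf lg !scalerDr !scalerA (mulrC k l) -!addrA.
  by congr (_ + _); rewrite addrCA.
move=> x; apply: (@continuousD _ _ _ (k *: f) g) (cg x).
  exact: (@continuousZl_tmp R[i] C E f k x (cf x)).
Qed.

HB.instance Definition _ :=
  GRing.isSubmodClosed.Build R[i] (E -> C) dual_pred dual_submod_closed.

Record dual := Dual {dual_val :> E -> C; _ : dual_val \in dual_pred}.

HB.instance Definition _ := [isSub for dual_val].
HB.instance Definition _ := [Choice of dual by <:].
HB.instance Definition _ := [SubChoice_isSubLmodule of dual by <:].

Lemma dual_linear (F : dual) : linear F.
Proof. by case: F => f /= /dual_predP[]. Qed.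

HB.instance Definition _ (F : dual) :=
  GRing.isLinear.Build R[i] E C *:%R F (dual_linear F).

Lemma dual_continuous (F : dual) : continuous F.
Proof. by case: F => f /= /dual_predP[]. Qed.

Lemma dual_bounded (F : dual) :
  exists M : R, forall x, rnorm (F x) <= M * rnorm x.
Proof.
have /linear_boundedP/pinfty_ex_gt0[r r0 rF] :=
  (linear_bounded_continuous F).2 (@dual_continuous F).
exists (complex.Re r) => x; rewrite -lecR rmorphM/= !rnormE.
by rewrite RRe_real ?gtr0_real// rF.
Qed.

(* The operator norm sup {|F x| : |x| <= 1}. *)
Definition dnorm (F : dual) : R :=
  sup [set rnorm (F x) | x in [set x : E | `|x| <= 1]].

Lemma ler_dnorm (F : dual) (x : E) : `|x| <= 1 -> rnorm (F x) <= dnorm F.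
Proof.
move=> x1; apply: sup_upper_bound; last by exists x.
have [M FM] := dual_bounded F; split; first by exists (rnorm (F x)), x.
exists `|M| => _ [y /= y1 <-]; apply: (le_trans (FM y)).
rewrite (le_trans (ler_norm _))// normrM -[leRHS]mulr1 ler_wpM2l//.
by rewrite ger0_norm ?rnorm_ge0// -lecR rnormE.
Qed.

Lemma dnorm_ge0 (F : dual) : 0 <= dnorm F.
Proof.
apply: le_trans (rnorm_ge0 (F 0)) (ler_dnorm _ _).
by rewrite normr0 ler01.
Qed.

Lemma dnorm_ler (F : dual) (M : R) :
  (forall x, `|x| <= 1 -> rnorm (F x) <= M) -> dnorm F <= M.
Proof.
move=> FM; apply: ge_sup; last by move=> _ [x x1 <-]; exact: FM.
by exists (rnorm (F 0)), 0 => //=; rewrite normr0.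
Qed.

Lemma dnormD (F G : dual) : dnorm (F + G) <= dnorm F + dnorm G.
Proof.
apply: dnorm_ler => x x1; apply: (le_trans (rnormD (F x) (G x))).
by rewrite lerD ?ler_dnorm.
Qed.

Lemma Re_norm_ge0 (k : R[i]) : 0 <= complex.Re `|k|.
Proof. by exact: (rnorm_ge0 (k : C)). Qed.

Lemma dnormZ_le (k : R[i]) (F : dual) :
  dnorm (k *: F) <= complex.Re `|k| * dnorm F.
Proof.
apply: dnorm_ler => x x1.
have -> : rnorm ((k *: F) x) = complex.Re `|k| * rnorm (F x).
  apply: (@complexI R); rewrite rmorphM/= !rnormE/=.
  exact: (normrZ k (F x : C)).
by rewrite ler_wpM2l ?ler_dnorm ?Re_norm_ge0.
Qed.

Fact dual_ler_normD (F G : dual) :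
  (dnorm (F + G))%:C <= (dnorm F)%:C + (dnorm G)%:C.
Proof. by rewrite -rmorphD lecR dnormD. Qed.

Fact dual_normrZ (k : R[i]) (F : dual) :
  (dnorm (k *: F))%:C = `|k| * (dnorm F)%:C.
Proof.
rewrite -[`|k|]RRe_real ?ger0_real// -rmorphM; congr _%:C.
apply/le_anti; rewrite dnormZ_le andTb.
have [->|k0] := eqVneq k 0.
  by rewrite normr0 mul0r scale0r dnorm_ge0.
have := dnormZ_le k^-1 (k *: F); rewrite scalerA mulVf// scale1r => le.
apply: (le_trans (ler_wpM2l (Re_norm_ge0 k) le)).
rewrite mulrA -[leRHS]mul1r ler_wpM2r ?dnorm_ge0//.
suff -> : complex.Re `|k| * complex.Re `|k^-1| = 1 by [].
apply: (@complexI R); rewrite rmorphM; transitivity (`|k| * `|k^-1|).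
  by congr (_ * _); exact: (rnormE (_ : C)).
by rewrite -normrM mulfV// normr1.
Qed.

Fact dual_normr0_eq0 (F : dual) : (dnorm F)%:C = 0 -> F = 0.
Proof.
move=> /complexI F0; apply/val_inj/funext => x /=.
have [->|x0] := eqVneq x 0; first exact: (linear0 F).
have : rnorm (F (`|x|^-1 *: x)) <= 0.
  rewrite -F0 ler_dnorm// normrZ normfV normr_id mulVf ?normr_eq0//.
move=> le0; have /rnorm_eq0 : rnorm (F (`|x|^-1 *: x)) = 0.
  by apply/le_anti; rewrite le0 rnorm_ge0.
rewrite linearZ/= => /eqP; rewrite scaler_eq0 invr_eq0 normr_eq0 (negPf x0).
by move=> /eqP.
Qed.

HB.instance Definition _ := Lmodule_isNormed.Build R[i] dual
  dual_ler_normD dual_normrZ dual_normr0_eq0.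

End Dual.

Section Amenability.
Variables (R : realType) (A : banachAlgType R[i]).
Local Notation C := (R[i]^o).

Fact dual_ract_in (F : dual A) (a : A) :
  ((fun x => F (a ⊙ x)) : A -> C) \in @dual_pred R A.
Proof.
apply/dual_predP; split=> [k x y|].
  by rewrite bmulDr bmulZr linearP.
pose f x := a ⊙ x.
have fl : linear f by move=> k x y; rewrite /f bmulDr bmulZr.
pose fL := GRing.isLinear.Build R[i] A A *:%R f fl.
pose g : {linear A -> A} := HB.pack f fL.
have gc : continuous g.
  apply/linear_bounded_continuous/linear_boundedP.
  near=> r => x; rewrite (le_trans (ler_norm_bmul _ _))// ler_wpM2r//.
  by near: r; apply: nbhs_pinfty_ge; rewrite normr_real.
move=> x; apply: (@continuous_comp _ _ _ g F) => //; first exact: gc.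
exact: dual_continuous.
Unshelve. all: by end_near. Qed.

Fact dual_lact_in (a : A) (F : dual A) :
  ((fun x => F (x ⊙ a)) : A -> C) \in @dual_pred R A.
Proof.
apply/dual_predP; split=> [k x y|].
  by rewrite bmulDl bmulZl linearP.
pose f x := x ⊙ a.
have fl : linear f by move=> k x y; rewrite /f bmulDl bmulZl.
pose fL := GRing.isLinear.Build R[i] A A *:%R f fl.
pose g : {linear A -> A} := HB.pack f fL.
have gc : continuous g.
  apply/linear_bounded_continuous/linear_boundedP.
  near=> r => x; rewrite (le_trans (ler_norm_bmul _ _))// mulrC ler_wpM2r//.
  by near: r; apply: nbhs_pinfty_ge; rewrite normr_real.
move=> x; apply: (@continuous_comp _ _ _ g F) => //; first exact: gc.
exact: dual_continuous.
Unshelve. all: by end_near. Qed.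

(* The actions <F . a, x> = <F, a x> and <a . F, x> = <F, x a>. *)
Definition dual_ract (F : dual A) (a : A) : dual A := Dual (dual_ract_in F a).
Definition dual_lact (a : A) (F : dual A) : dual A := Dual (dual_lact_in a F).

Definition derivation (D : {linear A -> dual A}) : Prop :=
  forall a b : A, D (a ⊙ b) = dual_ract (D a) b + dual_lact a (D b).

Definition cyclic_map (D : {linear A -> dual A}) : Prop :=
  forall a b : A, D a b + D b a = 0.

Definition inner_derivation (D : {linear A -> dual A}) : Prop :=
  exists F : dual A, forall a : A, D a = dual_ract F a - dual_lact a F.

Definition weakly_amenable : Prop :=
  forall D : {linear A -> dual A},
    derivation D -> continuous D -> inner_derivation D.

(* Continuity of D is not assumed here: a cyclic D is automatically continuous
   by the closed graph theorem. *)
Definition cyclically_amenable : Prop :=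
  forall D : {linear A -> dual A},
    derivation D -> cyclic_map D -> inner_derivation D.

Definition character_space : set {linear A -> C} :=
  [set phi | (exists a, phi a != 0) /\
             forall a b : A, phi (a ⊙ b) = phi a * phi b].

End Amenability.

Arguments character_space {R} A.

Section ProjectiveTensorProduct.
Variables (R : realType) (E1 E2 : normedModType R[i]).
Implicit Types s t : seq (E1 * E2).

(* The list [:: (x1, y1); ...; (xn, yn)] denotes x1 (x) y1 + ... + xn (x) yn.
   The algebraic tensor product of E1 and E2 is the quotient of these formal
   sums by the congruence tensor_eq. *)
Inductive tensor_eq : seq (E1 * E2) -> seq (E1 * E2) -> Prop :=
| tensor_refl s : tensor_eq s s
| tensor_sym s t : tensor_eq s t -> tensor_eq t s
| tensor_trans s t u : tensor_eq s t -> tensor_eq t u -> tensor_eq s u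
| tensor_cat s s' t t' :
    tensor_eq s s' -> tensor_eq t t' -> tensor_eq (s ++ t) (s' ++ t')
| tensor_catC s t : tensor_eq (s ++ t) (t ++ s)
| tensorDl x x' y : tensor_eq [:: (x + x', y)] [:: (x, y); (x', y)]
| tensorDr x y y' : tensor_eq [:: (x, y + y')] [:: (x, y); (x, y')]
| tensorZ (k : R[i]) x y : tensor_eq [:: (k *: x, y)] [:: (x, k *: y)]
| tensor0 y : tensor_eq [:: (0, y)] [::].

(* inf of sum_i |x_i| |y_i| over the representations of the tensor s. *)
Definition projective_norm s : R :=
  inf [set \sum_(p <- t) rnorm p.1 * rnorm p.2 | t in [set t | tensor_eq s t]].

(* (T, tau) is a model of the projective tensor product: T is a Banach space
   and the linear map from the algebraic tensor product to T induced by the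
   bilinear map tau is isometric for the projective norm with dense range, so
   that T is the completion of the algebraic tensor product. *)
Definition is_projective_tensor_product (T : completeNormedModType R[i])
    (tau : E1 -> E2 -> T) : Prop :=
  [/\ (forall y, linear (tau^~ y)),
      (forall x, linear (tau x)),
      (forall s, rnorm (\sum_(p <- s) tau p.1 p.2) = projective_norm s) &
      dense (range (fun s => \sum_(p <- s) tau p.1 p.2))].

End ProjectiveTensorProduct.

Definition is_projective_tensor_algebra (R : realType)
    (A1 A2 T : banachAlgType R[i]) (tau : A1 -> A2 -> T) : Prop :=
  is_projective_tensor_product tau /\
  forall a1 x1 a2 x2, tau a1 a2 ⊙ tau x1 x2 = tau (a1 ⊙ x1) (a2 ⊙ x2).

(* Main.v *)
(* A character phi of A2 is contractive, so a (x) b |-> phi(b) a extends to a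
   contractive homomorphism theta : T -> A1, with right inverse the homomorphism
   iota a = a (x) e2.  A derivation D of A1 pulls back to the derivation
   t |-> theta^* (D (theta t)) of T, which is cyclic or continuous when D is; if
   the latter is ad_F, then D = ad_(F o iota).  The same holds with the two
   factors exchanged. *)
From HB Require Import structures.
Require Import Defs.
From mathcomp Require Import all_boot all_order all_algebra.
From mathcomp Require Import complex.
From mathcomp Require Import all_classical reals topology normedtype sequences.
From mathcomp Require Import ring.

Set Implicit Arguments.
Unset Strict Implicit.
Unset Printing Implicit Defensive.
Import Order.TTheory GRing.Theory Num.Theory.
Import numFieldNormedType.Exports.
Local Open Scope classical_set_scope.
Local Open Scope ring_scope.
Local Open Scope complex_scope.

(** * Extension and uniqueness of continuous maps by density *)

(** The value [f x] is the limit of [p.2] as [p] runs through [G] with [p.1] tending to [x]; it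
    exists by completeness of [Y]. A relation [G] in place of a function avoids choosing
    representatives: the Lipschitz condition makes it single-valued. *)
Lemma lipschitz_extension (K : numFieldType) (X : normedModType K)
    (Y : completeNormedModType K) (G : set (X * Y)) :
    dense (fst @` G) ->
    (forall p q, G p -> G q -> `|p.2 - q.2| <= `|p.1 - q.1|) ->
  exists f : X -> Y, forall x p, G p -> `|f x - p.2| <= `|x - p.1|.
Proof.
move=> Gdense Glip.
suff /choice[f Gf] : forall x, exists y,
    forall p, G p -> `|y - p.2| <= `|x - p.1|.
  by exists f.
move=> x.
have Gnear (e : K) : 0 < e -> exists2 p, G p & `|x - p.1| < e.
  move=> e0; have [|y [/= xy [p Gp py]]] := Gdense (ball x e) _ (ball_open x e).
    by exists x; exact: ballxx.
  by exists p => //; rewrite -ball_normE -py in xy.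
(* The filter of second coordinates of points of [G] whose first coordinate is near [x]. *)
pose F := filter_from (nbhs x) (fun A => snd @` (G `&` fst @^-1` A)).
have FP : ProperFilter F.
  apply: filter_from_proper.
    apply: filter_from_filter; first by exists setT; exact: filterT.
    move=> A B xA xB; exists (A `&` B); first exact: filterI.
    by move=> _ [p [Gp [pA pB]] <-]; split; exists p.
  move=> A /nbhs_normP[e /= e0 eA]; have [p Gp xp] := Gnear _ e0.
  by exists p.2, p => //; split=> //; exact: eA.
have : cvg F.
  apply: cauchy_cvg; apply: cauchy_exP => e e0.
  have e20 : 0 < e / 2 by rewrite divr_gt0.
  have [p Gp xp] := Gnear _ e20.
  exists p.2; exists (ball x (e / 2)); first exact: nbhsx_ballx.
  move=> _ [q [Gq /= xq] <-]; rewrite -ball_normE/=.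
  rewrite -ball_normE/= in xq.
  apply: (le_lt_trans (Glip _ _ Gp Gq)).
  rewrite (le_lt_trans (ler_distD x _ _))// (splitr e) ltrD// distrC//.
(* Compare [y] with [p.2] through some [q] in [G] with [q.1] within [e / 2] of [x] and [q.2] within
   [e / 2] of [y]. *)
move=> /cvg_ex[y Fy]; exists y => p Gp; apply/ler_addgt0Pl => e e0.
have e20 : 0 < e / 2 by rewrite divr_gt0.
have [A xA AF] : F (ball y (e / 2)) by apply: Fy; exact: nbhsx_ballx.
have : nbhs x (A `&` ball x (e / 2)).
  by apply: filterI => //; exact: nbhsx_ballx.
move=> /nbhs_normP[d /= d0 dA]; have [q Gq xq] := Gnear _ d0.
have [Aq] := dA _ xq; rewrite -ball_normE/= => xqe.
have : ball y (e / 2) q.2 by apply: AF; exists q.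
rewrite -ball_normE/= => yqe.
rewrite (le_trans (ler_distD q.2 _ _))// (splitr e) -addrA lerD ?(ltW yqe)//.
rewrite (le_trans (Glip _ _ Gq Gp))// (le_trans (ler_distD x _ _))//.
by rewrite lerD// distrC ltW.
Qed.

(** The set where [f - g] is nonzero is open, so it would meet [D] if it were nonempty. *)
Lemma dense_continuous_eq (K : numFieldType) (X : topologicalType)
    (Y : normedModType K) (D : set X) (f g : X -> Y) :
  dense D -> continuous f -> continuous g -> {in D, f =1 g} -> f = g.
Proof.
move=> Ddense fc gc fg; apply/funext => x; apply/eqP; rewrite -subr_eq0.
apply/negPn/negP => fgx.
have hc : continuous (f \- g).
  by move=> y; apply: continuousB; [exact: fc|exact: gc].
have Y0 : open (~` [set (0 : Y)]).
  apply: closed_openC; apply: accessible_closed_set1.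
  by apply: hausdorff_accessible; exact: norm_hausdorff.
have [|y [/= fgy Dy]] := Ddense _ _ ((continuousP (f \- g)).1 hc _ Y0).
  by exists x; exact/eqP.
by apply: fgy; rewrite fg ?subrr// inE.
Qed.

Section RealNormTheory.
Variables (R : realType) (E F : normedModType R[i]).

Lemma ler_rnorm (x : E) (y : F) : (rnorm x <= rnorm y) = (`|x| <= `|y|).
Proof. by rewrite -lecR !rnormE. Qed.

End RealNormTheory.

(** * Universal property of the projective tensor product *)

Section UniversalProperty.
Variables (R : realType) (E1 E2 : normedModType R[i]).
Variables (T : completeNormedModType R[i]) (tau : E1 -> E2 -> T).
Hypothesis tensorT : is_projective_tensor_product tau.

Lemma tensor_norm_le x y : `|tau x y| <= `|x| * `|y|.
Proof.
have [_ _ tau_norm _] := tensorT.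
rewrite -!rnormE -rmorphM lecR.
have := tau_norm [:: (x, y)]; rewrite big_seq1/= => ->.
apply: ge_inf.
  exists 0 => _ [t _ <-]; apply: sumr_ge0 => p _.
  by rewrite mulr_ge0 ?rnorm_ge0.
by exists [:: (x, y)]; [exact: tensor_refl|rewrite big_seq1].
Qed.

(** Stated for arbitrary continuous maps, so that it can serve to prove the linearity of the
    extension in [tensor_universal]. *)
Lemma tensor_sum_ext (Y : normedModType R[i]) (f g : T -> Y) :
    continuous f -> continuous g ->
    (forall s, let t := \sum_(p <- s) tau p.1 p.2 in f t = g t) ->
  f = g.
Proof.
move=> fc gc fg; have [_ _ _ tau_dense] := tensorT.
by apply: (dense_continuous_eq tau_dense) => // _ /set_mem[s _ <-]; exact: fg.
Qed.

Lemma tensor_ext (Y : normedModType R[i]) (f g : {linear T -> Y}) :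
    continuous f -> continuous g ->
  (forall x y, f (tau x y) = g (tau x y)) -> f =1 g.
Proof.
move=> fc gc fg; apply/funeqP; apply: tensor_sum_ext => //= s.
by rewrite !linear_sum; apply: eq_bigr => p _; exact: fg.
Qed.

Section Factorization.
Variables (Y : completeNormedModType R[i]) (beta : E1 -> E2 -> Y).
Hypothesis betal : forall y, linear (beta^~ y).
Hypothesis betar : forall x, linear (beta x).
Hypothesis beta_norm : forall x y, `|beta x y| <= `|x| * `|y|.

(** Each generating relation of [tensor_eq] holds in [Y] by bilinearity of [beta] or commutativity
    of addition, so [beta] descends to the algebraic tensor product. *)
Lemma bilinear_tensor_eq s t : tensor_eq s t ->
  \sum_(p <- s) beta p.1 p.2 = \sum_(p <- t) beta p.1 p.2.
Proof.
pose bl y : {linear E1 -> Y} :=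
  HB.pack (beta^~ y) (GRing.isLinear.Build R[i] E1 Y *:%R _ (betal y)).
pose br x : {linear E2 -> Y} :=
  HB.pack (beta x) (GRing.isLinear.Build R[i] E2 Y *:%R _ (betar x)).
elim=> //=.
- by move=> s1 t1 u1 _ -> _ ->.
- by move=> s1 s2 t1 t2 _ e1 _ e2; rewrite !big_cat/= e1 e2.
- by move=> s1 t1; rewrite !big_cat/= addrC.
- move=> x x' y; rewrite !big_cons !big_nil !addr0.
  exact: (linearD (bl y)).
- move=> x y y'; rewrite !big_cons !big_nil !addr0.
  exact: (linearD (br x)).
- move=> k x y; rewrite !big_seq1/=.
  exact: etrans (linearZ_LR (bl y) k x) (esym (linearZ_LR (br x) k y)).
- by move=> y; rewrite big_seq1 big_nil; exact: (linear0 (bl y)).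
Qed.

(** The left side depends only on the tensor, so the triangle inequality bounds it by every
    representation of [s], hence by their infimum. *)
Lemma norm_bilinear_sum_le s :
  `|\sum_(p <- s) beta p.1 p.2| <= `|\sum_(p <- s) tau p.1 p.2|.
Proof.
have [_ _ tau_norm _] := tensorT.
rewrite -ler_rnorm tau_norm; apply: lb_le_inf.
  by eexists; exists s => //; exact: tensor_refl.
move=> _ [t st <-]; rewrite (bilinear_tensor_eq st) -lecR rnormE.
rewrite (le_trans (ler_norm_sum _ _ _))// rmorph_sum/=.
by apply: ler_sum => p _; rewrite rmorphM/= !rnormE.
Qed.

(** The assignment of [B s] to [S s] is 1-Lipschitz on a dense set, and its extension inherits
    linearity by continuity. *)
Lemma tensor_universal : exists theta : {linear T -> Y},
  (forall t, `|theta t| <= `|t|) /\ forall x y, theta (tau x y) = beta x y.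
Proof.
have [taul taur _ tau_dense] := tensorT.
pose S s := \sum_(p <- s) tau p.1 p.2.
pose B s := \sum_(p <- s) beta p.1 p.2.
(* Scaling first factors and concatenating realise linear combinations on formal sums, so a
   difference [S s - S s'] is again the value of [S] at a list. *)
pose sc (k : R[i]) (s : seq (E1 * E2)) := [seq (k *: p.1, p.2) | p <- s].
have scale_sum (V : normedModType R[i]) (g : E1 -> E2 -> V) k s :
    (forall y, linear (g^~ y)) ->
    \sum_(p <- sc k s) g p.1 p.2 = k *: \sum_(p <- s) g p.1 p.2.
  move=> gl; rewrite big_map scaler_sumr; apply: eq_bigr => p _ /=.
  pose gL : {linear E1 -> V} :=
    HB.pack (g^~ p.2) (GRing.isLinear.Build R[i] E1 V *:%R _ (gl p.2)).
  exact: (linearZ_LR gL).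
have S_lin k s s' : S (sc k s ++ s') = k *: S s + S s'.
  by rewrite /S big_cat/= scale_sum.
have B_lin k s s' : B (sc k s ++ s') = k *: B s + B s'.
  by rewrite /B big_cat/= scale_sum.
have BS s s' : `|B s - B s'| <= `|S s - S s'|.
  have := norm_bilinear_sum_le (sc (-1) s' ++ s).
  by rewrite -/(B _) -/(S _) S_lin B_lin !scaleN1r ![- _ + _]addrC.
have [||f fS] := @lipschitz_extension _ T Y (range (fun s => (S s, B s))).
- by rewrite image_comp.
- by move=> _ _ [s _ <-] [s' _ <-]; exact: BS.
have {}fS t s : `|f t - B s| <= `|t - S s|.
  by apply: (fS t (S s, B s)); exists s.
have fSs s : f (S s) = B s.
  by apply/eqP; rewrite -subr_eq0 -normr_le0 (le_trans (fS _ _))// subrr normr0.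
have f_near t (e : R[i]) : 0 < e -> exists s, `|t - S s| < e.
  move=> e0.
  have [|u [/= tu [s _ su]]] := tau_dense (ball t e) _ (ball_open t e).
    by exists t; exact: ballxx.
  by exists s; rewrite -ball_normE -su in tu.
have f_lip t u : `|f t - f u| <= `|t - u|.
  apply/ler_addgt0Pl => e e0; have e20 : 0 < e / 2 by rewrite divr_gt0.
  (* The error [e] splits in two halves because [|u - S s|] enters twice: in passing from [S s] to
     [u], and from [B s] to [f u]. *)
  have [s us] := f_near u _ e20.
  rewrite (le_trans (ler_distD (B s) _ _))//.
  rewrite (le_trans (lerD (fS t s) (lexx _)))//.
  rewrite (le_trans (lerD (ler_distD u _ _) (lexx _)))//.
  rewrite [`|B s - _|]distrC.
  rewrite [e + _]addrC -addrA lerD2l (splitr e) lerD//; first exact: ltW.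
  by rewrite (le_trans (fS _ _))// ltW.
have f_cont : continuous f.
  move=> t; apply/cvgrPdist_lt => e e0; apply/nbhs_normP.
  by exists e => // u /= tu; exact: le_lt_trans (f_lip t u) tu.
have scaleD_cont (V : normedModType R[i]) (k : R[i]) (v : V) :
    continuous (fun t => k *: t + v).
  by move=> t; apply: cvgD; [apply: cvgZl_tmp; exact: cvg_id|exact: cvg_cst].
(* Linearity is obtained one argument at a time: first with the added vector a finite sum, then with
   it arbitrary. *)
have f_linear_sum k s : forall t, f (k *: t + S s) = k *: f t + B s.
  apply/funeqP; apply: tensor_sum_ext => [t|t|s' /=].
  - by apply: continuous_comp; [exact: scaleD_cont|exact: f_cont].
  - apply: (@continuous_comp _ _ _ f (fun y => k *: y + B s)).
      exact: f_cont.
    exact: scaleD_cont.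
  - by rewrite -S_lin fSs B_lin fSs.
have f_linear : linear f.
  move=> k t; apply/funeqP; apply: tensor_sum_ext => [u|u|s /=].
  - apply: (@continuous_comp _ _ _ (fun u => k *: t + u) f); last exact: f_cont.
    by apply: cvgD; [exact: cvg_cst|exact: cvg_id].
  - by apply: cvgD; [exact: cvg_cst|exact: f_cont].
  - by rewrite f_linear_sum fSs.
pose theta : {linear T -> Y} :=
  HB.pack f (GRing.isLinear.Build R[i] T Y *:%R f f_linear).
exists theta; split=> [t|x y].
  by have := f_lip t 0; rewrite (_ : f 0 = 0) ?subr0//; exact: (linear0 theta).
by have := fSs [:: (x, y)]; rewrite /S /B !big_seq1.
Qed.

End Factorization.
End UniversalProperty.

(** * Continuity of bounded linear maps *)

Section Contraction.
Variables (K : numFieldType) (V W : normedModType K) (f : {linear V -> W}).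

Lemma linear_le_continuous (M : K) :
  0 <= M -> (forall x, `|f x| <= M * `|x|) -> continuous f.
Proof.
move=> M0 fM; apply/linear_bounded_continuous/linear_boundedP.
near=> r => x; rewrite (le_trans (fM x))// ler_wpM2r//.
by near: r; apply: nbhs_pinfty_ge; exact: ger0_real.
Unshelve. all: by end_near. Qed.

Lemma contractive_continuous : (forall x, `|f x| <= `|x|) -> continuous f.
Proof.
by move=> fx; apply: (@linear_le_continuous 1) => // x; rewrite mul1r.
Qed.

End Contraction.

(** * Multiplication operators and characters of a Banach algebra *)

Section BanachAlgebra.
Variables (R : realType) (A : banachAlgType R[i]).

Lemma bmul_linear (a : A) : linear (bmul a).
Proof. by move=> k x y; rewrite bmulDr bmulZr. Qed.

HB.instance Definition _ (a : A) :=
  GRing.isLinear.Build R[i] A A *:%R (bmul a) (bmul_linear a).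

Definition rmul (a x : A) : A := x ⊙ a.

Lemma rmul_linear (a : A) : linear (rmul a).
Proof. by move=> k x y; rewrite /rmul bmulDl bmulZl. Qed.

HB.instance Definition _ (a : A) :=
  GRing.isLinear.Build R[i] A A *:%R (rmul a) (rmul_linear a).

Lemma bmul_continuous (a : A) : continuous (bmul a).
Proof.
by apply: (linear_le_continuous (M := `|a|)) => // x; exact: ler_norm_bmul.
Qed.

Lemma rmul_continuous (a : A) : continuous (rmul a).
Proof.
apply: (linear_le_continuous (M := `|a|)) => // x.
by rewrite mulrC; exact: ler_norm_bmul.
Qed.

(* [y] is the sum of the series [a + a ^ 2 + a ^ 3 + ...]. *)
Lemma geometric_fixpoint (a : A) : `|a| < 1 -> exists y, y = a + a ⊙ y.
Proof.
move=> a1.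
pose s := fix s n := if n is n'.+1 then a + a ⊙ s n' else 0.
pose M := `|a| / (1 - `|a|).
have a1' : 0 < 1 - `|a| by rewrite subr_gt0.
have M0 : 0 <= M by rewrite divr_ge0// ltW.
have sM n : `|s n| <= M.
  elim: n => [|n ih]; first by rewrite normr0.
  rewrite /= (le_trans (ler_normD _ _))//.
  have -> : M = `|a| + `|a| * M.
    by rewrite /M; field; rewrite gt_eqF.
  by rewrite lerD2l (le_trans (ler_norm_bmul _ _))// ler_wpM2l.
have sD n k : `|s n - s (n + k)%N| <= `|a| ^+ n * M.
  elim: n => [|n ih]; first by rewrite expr0 mul1r add0n sub0r normrN.
  rewrite addSn /= opprD addrACA subrr add0r -linearB /=.
  by rewrite (le_trans (ler_norm_bmul _ _))// exprS -mulrA ler_wpM2l.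
have /cvg_ex[y sy] : cvg (s @ \oo).
  apply: cauchy_cvg; apply: cauchy_exP => e e0.
  have [n an] : exists n, `|a| ^+ n * M < e.
    (* Norms are elements of [R[i]]; the geometric decay is taken over [R] through real parts and
       then carried back. *)
    have rn_lt1 : `|rnorm a| < 1 by rewrite ger0_norm ?rnorm_ge0// -ltcR rnormE.
    have Me0 : 0 < complex.Re e by rewrite -ltcR RRe_real ?gtr0_real.
    have /cvgrPdist_lt/(_ _ Me0)[n _ /(_ n (leqnn n))] :=
      cvg_geometric (complex.Re M) rn_lt1.
    rewrite sub0r normrN => /(le_lt_trans (ler_norm _)).
    rewrite -ltcR rmorphM/= rmorphXn/= rnormE.
    rewrite !RRe_real ?(gtr0_real e0) ?ger0_real//.
    by exists n; rewrite mulrC.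
  exists (s n); exists n => // m /= nm; rewrite -ball_normE/=.
  by rewrite (le_lt_trans _ an)// -(subnKC nm).
exists y.
(* The shifted sequence also tends to [a + a ⊙ y], by its recursion; limits are unique. *)
have sy1 : (fun n => s n.+1) @ \oo --> y by rewrite -cvg_shiftS in sy.
apply: (cvg_unique _ sy1); first exact: norm_hausdorff.
apply: cvgD; first exact: cvg_cst.
by apply: continuous_cvg; [exact: bmul_continuous|exact: sy].
Qed.

Variables (phi : {linear A -> R[i]^o}).
Hypothesis phi_char : character_space A phi.

Lemma character_unit (e : A) : (forall a, e ⊙ a = a) -> phi e = 1.
Proof.
move=> e1; have [[a phia] phiM] := phi_char.
by apply: (mulIf phia); rewrite -phiM e1 mul1r.
Qed.

(* If [phi b = 1] with [`|b| < 1] then a solution of [y = b + b y] would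
   satisfy [phi y = 1 + phi y]. *)
Lemma character_contractive (a : A) : `|phi a| <= `|a|.
Proof.
have [_ phiM] := phi_char.
rewrite real_leNgt ?normr_real//; apply/negP => aphi.
have phia : phi a != 0.
  by rewrite -normr_gt0 (le_lt_trans _ aphi).
have [|y yE] := @geometric_fixpoint ((phi a)^-1 *: a).
  by rewrite normrZ normfV mulrC ltr_pdivrMr ?mul1r// normr_gt0.
have phib : phi ((phi a)^-1 *: a) = 1 by rewrite linearZ; exact: mulVf.
have := congr1 phi yE; rewrite linearD phiM phib mul1r => /eqP.
by rewrite -subr_eq0 opprD addrCA subrr addr0 oppr_eq0 oner_eq0.
Qed.

End BanachAlgebra.

(** * Adjoints of continuous linear maps *)

Section DualMap.
Variables (R : realType) (V W : normedModType R[i]) (f : {linear V -> W}).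
Hypothesis fc : continuous f.

Fact dual_map_in (F : dual W) : F \o f \in @dual_pred R V.
Proof.
apply/dual_predP; split=> [k x y|x]; first by rewrite /= !linearP.
by apply: continuous_comp; [exact: fc|exact: dual_continuous].
Qed.

Definition dual_map (F : dual W) : dual V := Dual (dual_map_in F).

Lemma dual_map_linear : linear dual_map.
Proof. by move=> k F G; apply/val_inj/funext. Qed.

HB.instance Definition _ :=
  GRing.isLinear.Build R[i] (dual W) (dual V) *:%R dual_map dual_map_linear.

End DualMap.

(** A contraction maps the unit ball into the unit ball, so its adjoint does not increase
    [dnorm]. *)
Lemma dual_map_continuous (R : realType) (V W : normedModType R[i])
    (f : {linear V -> W}) (fc : continuous f) :
  (forall x, `|f x| <= `|x|) -> continuous (dual_map fc).
Proof.
move=> fle; apply: contractive_continuous => F.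
rewrite /Num.norm/= lecR; apply: dnorm_ler => x x1.
exact: (@ler_dnorm _ _ F (f x) (le_trans (fle x) x1)).
Qed.

(** * Amenability passes to retracts *)

Section Retract.
Variables (R : realType) (A B : banachAlgType R[i]).
Variables (theta : {linear B -> A}) (iota : {linear A -> B}).
Hypothesis theta_le : forall x, `|theta x| <= `|x|.
Hypothesis thetaM : forall x y, theta (x ⊙ y) = theta x ⊙ theta y.
Hypothesis iota_cont : continuous iota.
Hypothesis iotaM : forall x y, iota (x ⊙ y) = iota x ⊙ iota y.
Hypothesis iotaK : cancel iota theta.

Let theta_cont : continuous theta := contractive_continuous theta_le.

Definition pullback (D : {linear A -> dual A}) : {linear B -> dual B} :=
  dual_map theta_cont \o D \o theta.

Lemma pullback_derivation D : derivation D -> derivation (pullback D).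
Proof.
move=> dD a b; apply/val_inj/funext => x.
change (D (theta (a ⊙ b)) (theta x) =
  D (theta a) (theta (b ⊙ x)) + D (theta b) (theta (x ⊙ a))).
by rewrite !thetaM dD.
Qed.

(** Evaluating [pullback D] at [iota a] and [iota x] recovers [D a x], because [iota] is a section
    of [theta]. *)
Lemma pullback_inner D : inner_derivation (pullback D) -> inner_derivation D.
Proof.
move=> [F DF]; exists (dual_map iota_cont F) => a; apply/val_inj/funext => x.
change (D a x = F (iota (a ⊙ x)) - F (iota (x ⊙ a))).
have : D (theta (iota a)) (theta (iota x)) =
    F (iota a ⊙ iota x) - F (iota x ⊙ iota a).
  by rewrite -[LHS]/(pullback D (iota a) (iota x)) DF.
by rewrite !iotaK !iotaM.
Qed.

Lemma retract_cyclically_amenable :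
  cyclically_amenable B -> cyclically_amenable A.
Proof.
move=> Bam D dD cD; apply/pullback_inner/Bam; first exact: pullback_derivation.
(* Cyclicity of the pullback at [a], [b] is by conversion that of [D] at [theta a], [theta b]. *)
by move=> a b; exact: cD.
Qed.

Lemma retract_weakly_amenable : weakly_amenable B -> weakly_amenable A.
Proof.
move=> Bam D dD cD; apply/pullback_inner/Bam; first exact: pullback_derivation.
move=> x; apply: (@continuous_comp _ _ _ theta (dual_map theta_cont \o D)).
  exact: theta_cont.
by apply: continuous_comp; [exact: cD|exact: dual_map_continuous].
Qed.

End Retract.

(** * Homomorphisms out of the projective tensor algebra *)

Section TensorRetract.
Variables (R : realType) (A1 A2 T A : banachAlgType R[i]) (tau : A1 -> A2 -> T).
Hypothesis tensorT : is_projective_tensor_algebra tau.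

(** Multiplicativity spreads from elementary tensors to all of [T] one factor at a time:
    [tensor_ext] first frees the right factor, then the left one. *)
Lemma tensor_hom (beta : A1 -> A2 -> A) :
    (forall y, linear (beta^~ y)) -> (forall x, linear (beta x)) ->
    (forall x y, `|beta x y| <= `|x| * `|y|) ->
    (forall a b x y, beta (a ⊙ x) (b ⊙ y) = beta a b ⊙ beta x y) ->
  exists theta : {linear T -> A},
    [/\ forall t, `|theta t| <= `|t|,
        forall s t, theta (s ⊙ t) = theta s ⊙ theta t &
        forall x y, theta (tau x y) = beta x y].
Proof.
move=> betal betar beta_le betaM; have [tensT tauM] := tensorT.
have [theta [theta_le thetaE]] := tensor_universal tensT betal betar beta_le.
have theta_cont := contractive_continuous theta_le.
exists theta; split=> //.
have thetaMr a b t : theta (tau a b ⊙ t) = theta (tau a b) ⊙ theta t.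
  apply: (tensor_ext tensT (f := theta \o bmul (tau a b))
    (g := bmul (theta (tau a b)) \o theta)) => [x|x|x y /=].
  - by apply: continuous_comp; [exact: bmul_continuous|exact: theta_cont].
  - by apply: continuous_comp; [exact: theta_cont|exact: bmul_continuous].
  - by rewrite tauM !thetaE betaM.
move=> s t.
apply: (tensor_ext tensT (f := theta \o rmul t) (g := rmul (theta t) \o theta)).
- move=> x; apply: continuous_comp; first exact: rmul_continuous.
  exact: theta_cont.
- move=> x; apply: continuous_comp; first exact: theta_cont.
  exact: rmul_continuous.
- by move=> x y; exact: thetaMr.
Qed.

End TensorRetract.

(** * Each factor as a retract of the tensor algebra *)

Section CharacterSlices.
Variables (R : realType) (A1 A2 T : banachAlgType R[i]) (tau : A1 -> A2 -> T).
Hypothesis tensorT : is_projective_tensor_algebra tau.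

(** The map [iota] is multiplicative because [e2] is idempotent, and a section of [theta] because
    [phi e2 = 1]. *)
Lemma left_retract (e2 : A2) (phi : {linear A2 -> R[i]^o}) :
    (forall b, e2 ⊙ b = b /\ b ⊙ e2 = b) -> character_space A2 phi ->
  exists (theta : {linear T -> A1}) (iota : {linear A1 -> T}),
    [/\ forall t, `|theta t| <= `|t|,
        forall s t, theta (s ⊙ t) = theta s ⊙ theta t,
        continuous iota,
        forall x y, iota (x ⊙ y) = iota x ⊙ iota y &
        cancel iota theta].
Proof.
move=> e2P phi_char; have [[taul _ _ _] tauM] := tensorT.
have [_ phiM] := phi_char.
have [||||theta [theta_le thetaM thetaE]] :=
  @tensor_hom _ _ _ _ A1 _ tensorT (fun a b => (phi b : R[i]) *: a).
- by move=> b k x y; rewrite scalerDr !scalerA mulrC.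
- by move=> a k x y; rewrite linearP scalerDl -scalerA.
- move=> x y; rewrite normrZ mulrC ler_wpM2l//; exact: character_contractive.
- by move=> a b x y; rewrite phiM bmulZl bmulZr scalerA.
pose iota : {linear A1 -> T} :=
  HB.pack (tau^~ e2) (GRing.isLinear.Build R[i] A1 T *:%R _ (taul e2)).
exists theta, iota; split=> //.
(* The unit is not assumed to have norm 1, so the bound obtained for [iota] is [|e2|]. *)
- apply: (linear_le_continuous (M := `|e2|)) => // x.
  by rewrite mulrC; apply: tensor_norm_le; case: tensorT.
- by move=> x y; rewrite /= tauM (e2P e2).1.
- move=> x; rewrite /= thetaE (character_unit phi_char) ?scale1r// => b.
  exact: (e2P b).1.
Qed.

(** Mirror image of [left_retract], slicing the first factor by [phi]. *)
Lemma right_retract (e1 : A1) (phi : {linear A1 -> R[i]^o}) :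
    (forall a, e1 ⊙ a = a /\ a ⊙ e1 = a) -> character_space A1 phi ->
  exists (theta : {linear T -> A2}) (iota : {linear A2 -> T}),
    [/\ forall t, `|theta t| <= `|t|,
        forall s t, theta (s ⊙ t) = theta s ⊙ theta t,
        continuous iota,
        forall x y, iota (x ⊙ y) = iota x ⊙ iota y &
        cancel iota theta].
Proof.
move=> e1P phi_char; have [[_ taur _ _] tauM] := tensorT.
have [_ phiM] := phi_char.
have [||||theta [theta_le thetaM thetaE]] :=
  @tensor_hom _ _ _ _ A2 _ tensorT (fun a b => (phi a : R[i]) *: b).
- by move=> b k x y; rewrite linearP scalerDl -scalerA.
- by move=> a k x y; rewrite scalerDr !scalerA mulrC.
- move=> x y; rewrite normrZ ler_wpM2r//; exact: character_contractive.
- by move=> a b x y; rewrite phiM bmulZl bmulZr scalerA.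
pose iota : {linear A2 -> T} :=
  HB.pack (tau e1) (GRing.isLinear.Build R[i] A2 T *:%R _ (taur e1)).
exists theta, iota; split=> //.
- apply: (linear_le_continuous (M := `|e1|)) => // x.
  by apply: tensor_norm_le; case: tensorT.
- by move=> x y; rewrite /= tauM (e1P e1).1.
- move=> x; rewrite /= thetaE (character_unit phi_char) ?scale1r// => b.
  exact: (e1P b).1.
Qed.

End CharacterSlices.

Theorem theorem4p3 (R : realType) (A1 A2 : banachAlgType R[i])
    (unital1 : unital A1) (unital2 : unital A2)
    (Delta1 : character_space A1 !=set0) (Delta2 : character_space A2 !=set0)
    (T : banachAlgType R[i]) (tau : A1 -> A2 -> T)
    (tensorT : is_projective_tensor_algebra tau) :
  (cyclically_amenable T -> cyclically_amenable A1 /\ cyclically_amenable A2)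
  /\
  (weakly_amenable T -> weakly_amenable A1 /\ weakly_amenable A2).
Proof.
have [e1 e1P] := unital1; have [e2 e2P] := unital2.
have [phi1 phi1_char] := Delta1; have [phi2 phi2_char] := Delta2.
(* The retraction onto each factor uses the unit and a character of the other. *)
have [theta1 [iota1 [le1 M1 c1 iM1 K1]]] := left_retract tensorT e2P phi2_char.
have [theta2 [iota2 [le2 M2 c2 iM2 K2]]] := right_retract tensorT e1P phi1_char.
split=> amT; split.
- exact: (retract_cyclically_amenable le1 M1 c1 iM1 K1).
- exact: (retract_cyclically_amenable le2 M2 c2 iM2 K2).
- exact: (retract_weakly_amenable le1 M1 c1 iM1 K1).
- exact: (retract_weakly_amenable le2 M2 c2 iM2 K2).
Qed.
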